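(* Consider the energy sharing game with $N\ge 2$ prosumers, price sensitivity $a<0$, and parameters $c_i>0$, $d_i>0$, $D_i\in\mathbb{R}$ ($i\in\mathcal{I}=\{1,\dots,N\}$), as defined in the context, and let $(p^*,b^* )$ be its Nash equilibrium. Then $$\Pi_i(p_i^*,b^* )\le f_i(D_i)\qquad\text{for all } i\in\mathcal{I}.$$ Moreover, the inequality is strict for at least one $i$ unless the unique optimal solution $p^*$ of $$\min_{p\in\mathbb{R}^N}\ \sum_{i=1}^N\left[\left(c_i-\frac{1}{2(N-1)a}\right)p_i^2+\left(d_i+\frac{D_i}{(N-1)a}\right)p_i\right]\quad\text{s.t.}\quad \sum_{i=1}^N p_i=\sum_{i=1}^N D_i$$ is $p_i^*=D_i$ for all $i\in\mathcal{I}$.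
   Context: Energy sharing game. The players (prosumers) are $\mathcal{I}=\{1,\dots,N\}$. Prosumer $i$ has a required load reduction $D_i\in\mathbb{R}$ and disutility function $f_i(p_i)=c_ip_i^2+d_ip_i$ with $c_i,d_i>0$. The common price sensitivity is $a<0$. Each prosumer $i$ chooses an output adjustment $p_i\in\mathbb{R}$ and a bid $b_i\in\mathbb{R}$. Given the bids $b=(b_1,\dots,b_N)$, the sharing price is $\lambda_c(b)=-\frac{1}{Na}\sum_{j=1}^N b_j$ (equivalently, the market clears: $\sum_i(a\lambda_c+b_i)=0$), and prosumer $i$ buys the quantity $q_i(b)=a\lambda_c(b)+b_i$ (sells if negative). Given the other bids $b_{-i}$, prosumer $i$ minimizes $$\Pi_i(p_i,b)=\Pi_i(p_i,b_i,b_{-i})=c_ip_i^2+d_ip_i+(a\lambda_c(b)+b_i)\lambda_c(b)$$ over the action set $X_i(b_{-i})=\{(p_i,b_i)\in\mathbb{R}^2:\ p_i+a\lambda_c(b)+b_i=D_i\}$. A profile $(p^*,b^* )$ is a Nash equilibrium if for every $i$, $(p_i^*,b_i^* )\in X_i(b_{-i}^* )$ and $\Pi_i(p_i^*,b_i^*,b_{-i}^* )\le\Pi_i(p_i,b_i,b_{-i}^* )$ for all $(p_i,b_i)\in X_i(b_{-i}^* )$. This game has exactly one Nash equilibrium, and its component $p^*$ is the unique optimal solution of the optimization problem displayed in the claim. When prosumer $i$ acts individually (no sharing), the only decision is $p_i=D_i$, with cost $f_i(D_i)$. *)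

(* Defs.v *)
(* Everything is algebraic and order-theoretic, so the reals are generalized to
   an arbitrary ordered field R : realFieldType. *)
From mathcomp Require Import all_boot all_order all_algebra.

Set Implicit Arguments.
Unset Strict Implicit.
Unset Printing Implicit Defensive.

Import Order.TTheory GRing.Theory Num.Theory.
Local Open Scope ring_scope.

Section EnergySharing.

Variables (R : realFieldType) (N : nat).
Implicit Types (a x y : R) (c d D p b : 'I_N -> R) (i : 'I_N).

Definition disutility c d i x : R := c i * x ^+ 2 + d i * x.

Definition price a b : R := - (1 / (N%:R * a)) * \sum_j b j.

(* Negative when prosumer i sells. *)
Definition quantity a b i : R := a * price a b + b i.

(* Pi_i(p_i, b), with x standing for p_i. *)
Definition cost a c d i x b : R :=
  disutility c d i x + quantity a b i * price a b.

(* The bid profile (y, b_{-i}). *)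
Definition set_bid b i y : 'I_N -> R := [eta b with i |-> y].

(* (x, y) \in X_i(b_{-i}); the value b i is irrelevant. *)
Definition action_set a D i b x y : Prop :=
  x + a * price a (set_bid b i y) + y = D i.

Definition nash_equilibrium a c d D p b : Prop :=
  forall i,
    action_set a D i b (p i) (b i) /\
    forall x y, action_set a D i b x y ->
      cost a c d i (p i) (set_bid b i (b i)) <= cost a c d i x (set_bid b i y).

Definition objective a c d D p : R :=
  \sum_i ((c i - 1 / (2 * (N%:R - 1) * a)) * p i ^+ 2
          + (d i + D i / ((N%:R - 1) * a)) * p i).

Definition balanced D p : Prop := \sum_i p i = \sum_i D i.

Definition optimal a c d D p : Prop :=
  balanced D p /\
  forall q : 'I_N -> R, balanced D q ->
    objective a c d D p <= objective a c d D q.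

Definition unique_optimal a c d D p : Prop :=
  optimal a c d D p /\
  forall q : 'I_N -> R, optimal a c d D q -> q =1 p.

End EnergySharing.

(* Main.v *)
Require Import Defs.
From mathcomp Require Import all_boot all_order all_algebra.
From mathcomp Require Import ring.

Set Implicit Arguments.
Unset Strict Implicit.
Unset Printing Implicit Defensive.

Import Order.TTheory GRing.Theory Num.Theory.
Local Open Scope ring_scope.

(** Given the other bids, prosumer i can trade any quantity: buying t more than
    at present takes the bid b_i + N t / (N - 1), moves the price from lambda to
    lambda - t / ((N - 1) a), and by feasibility lowers p_i by t.  Along this
    line the cost is a quadratic in t with leading coefficient
    K_i = c_i - 1 / ((N - 1) a), which is positive because a < 0.  At a Nash
    equilibrium its minimum is at t = 0, so its linear coefficient vanishes:
      lambda = 2 c_i p_i + d_i + q_i / ((N - 1) a)          (stationarity).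
    The deviation t = - q_i, which is not to trade, then costs exactly
    K_i q_i ^ 2 more than the equilibrium; but not trading means p_i = D_i at
    cost f_i(D_i).  Hence Pi_i = f_i(D_i) - K_i q_i ^ 2, which gives the
    inequality, strict for every prosumer with q_i <> 0, that is, p_i <> D_i.

    As q_i = D_i - p_i, the right-hand side of stationarity is also the i-th
    partial derivative of the objective at p.  The gradient of the objective
    being the constant vector lambda, and p being balanced by market clearing,
    p is the unique optimum of the strictly convex program.  So if no inequality
    is strict, then p_i = D_i for all i and this profile is the optimum. *)

Section QuadraticMinimum.

Variable R : realFieldType.

Lemma quadratic_ge0_linear_coef0 (K L : R) :
  0 < K -> (forall t, 0 <= K * t ^+ 2 + L * t) -> L = 0.
Proof.
move=> K_gt0 /(_ (- (L / (2 * K)))) vertex_ge0; apply/eqP.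
have K_neq0 : K != 0 by rewrite gt_eqF.
have vertexE : K * (- (L / (2 * K))) ^+ 2 + L * - (L / (2 * K))
               = - (L ^+ 2 / (4 * K)) by field.
move: vertex_ge0; rewrite vertexE oppr_ge0 pmulr_lle0 ?invr_gt0 ?mulr_gt0 //.
by move=> sq_le0; rewrite -sqrf_eq0 eq_le sq_le0 sqr_ge0.
Qed.

End QuadraticMinimum.

Section EnergySharingGame.

Variables (R : realFieldType) (N : nat) (a : R).
Variables (c d D : 'I_N -> R).
Hypotheses (N_ge2 : (2 <= N)%N) (a_lt0 : a < 0) (c_gt0 : forall i, 0 < c i).
Implicit Types (p b : 'I_N -> R) (i : 'I_N) (t : R).

Let a_neq0 : a != 0. Proof. by rewrite lt_eqF. Qed.

Let N_neq0 : N%:R != 0 :> R.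
Proof. by rewrite pnatr_eq0 -lt0n (leq_trans _ N_ge2). Qed.

Let Nsub1_gt0 : 0 < N%:R - 1 :> R.
Proof. by rewrite subr_gt0 ltr1n. Qed.

Let Nsub1_neq0 : N%:R - 1 != 0 :> R. Proof. by rewrite gt_eqF. Qed.

Lemma set_bid_same b i y : set_bid b i y i = y.
Proof. by rewrite /set_bid /= eqxx. Qed.

Lemma sum_set_bid b i y :
  \sum_j set_bid b i y j = \sum_j b j + (y - b i).
Proof.
rewrite (bigD1 i) //= [in RHS](bigD1 i) //= set_bid_same.
rewrite (eq_bigr b) => [|j /negPf j_neq_i]; first by ring.
by rewrite /set_bid /= j_neq_i.
Qed.

Lemma price_set_bid_id b i : price a (set_bid b i (b i)) = price a b.
Proof. by rewrite /price sum_set_bid subrr addr0. Qed.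

Lemma cost_set_bid_id b i x :
  cost a c d i x (set_bid b i (b i)) = cost a c d i x b.
Proof. by rewrite /cost /quantity price_set_bid_id set_bid_same. Qed.

(** The bid with which prosumer i buys t more than under b, the other bids being
    fixed: raising a bid by N also lowers by 1 the part a * price of the quantity
    bought. *)
Definition shifted_bid b i t : R := b i + N%:R * t / (N%:R - 1).

Lemma price_shifted_bid b i t :
  price a (set_bid b i (shifted_bid b i t))
  = price a b - t / ((N%:R - 1) * a).
Proof.
rewrite /price sum_set_bid /shifted_bid.
by field; rewrite a_neq0 N_neq0 Nsub1_neq0.
Qed.

Lemma quantity_shifted_bid b i t :
  quantity a (set_bid b i (shifted_bid b i t)) i = quantity a b i + t.
Proof.
rewrite /quantity price_shifted_bid set_bid_same /shifted_bid.
by field; rewrite a_neq0 Nsub1_neq0.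
Qed.

Lemma action_set_shifted_bid b i x t :
  action_set a D i b x (shifted_bid b i t) <->
  x = D i - (quantity a b i + t).
Proof.
have := quantity_shifted_bid b i t.
rewrite /action_set {1}/quantity set_bid_same => <-.
rewrite -addrA; split=> [<-|->]; by ring.
Qed.

Lemma market_clearing b : \sum_i quantity a b i = 0.
Proof.
rewrite big_split /= sumr_const card_ord /price -mulr_natl.
by field; rewrite a_neq0 N_neq0.
Qed.

(** Half the second derivative of the cost of prosumer i in the quantity traded:
    the disutility contributes c_i, the price impact the rest. *)
Definition cost_curvature i : R := c i - 1 / ((N%:R - 1) * a).

Lemma cost_curvature_gt0 i : 0 < cost_curvature i.
Proof.
rewrite subr_gt0 (lt_trans _ (c_gt0 i)) // div1r invr_lt0.
by rewrite pmulr_rlt0.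
Qed.

Lemma cost_shifted_bid b i x t :
  cost a c d i (x - t) (set_bid b i (shifted_bid b i t))
  = cost a c d i x b + (cost_curvature i * t ^+ 2
    + (price a b - (2 * c i * x + d i + quantity a b i / ((N%:R - 1) * a))) * t).
Proof.
rewrite /cost quantity_shifted_bid price_shifted_bid.
rewrite /disutility /cost_curvature.
move: (quantity a b i) (price a b) => q l.
by field; rewrite a_neq0 Nsub1_neq0.
Qed.

Section Equilibrium.

Variables p b : 'I_N -> R.
Hypothesis NE : nash_equilibrium a c d D p b.

Lemma nash_production i : p i = D i - quantity a b i.
Proof.
have [feasible _] := NE i; move: feasible.
rewrite /action_set price_set_bid_id /quantity => <-; by ring.
Qed.

Lemma nash_balanced : balanced D p.
Proof.
rewrite /balanced (eq_bigr _ (fun i _ => nash_production i)).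
by rewrite sumrB market_clearing subr0.
Qed.

Lemma nash_stationarity i :
  price a b = 2 * c i * p i + d i + quantity a b i / ((N%:R - 1) * a).
Proof.
apply/eqP; rewrite -subr_eq0; apply/eqP.
apply: (quadratic_ge0_linear_coef0 (cost_curvature_gt0 i)) => t.
have [_ /(_ (p i - t) (shifted_bid b i t))] := NE i.
rewrite cost_set_bid_id cost_shifted_bid lerDl; apply.
apply/action_set_shifted_bid; rewrite nash_production; by ring.
Qed.

(** The deviation that cancels the trade leaves prosumer i with the cost of
    acting alone; by stationarity only the quadratic term of its cost remains. *)
Lemma nash_gain i :
  disutility c d i (D i)
  = cost a c d i (p i) b + cost_curvature i * quantity a b i ^+ 2.
Proof.
have := cost_shifted_bid b i (p i) (- quantity a b i).
rewrite {1}/cost quantity_shifted_bid addrN mul0r addr0 nash_production.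
rewrite opprK subrK => ->; rewrite -nash_production -nash_stationarity.
by rewrite subrr mul0r addr0 sqrrN.
Qed.

Lemma nash_cost_le i : cost a c d i (p i) b <= disutility c d i (D i).
Proof.
by rewrite nash_gain lerDl mulr_ge0 ?sqr_ge0 // ltW // cost_curvature_gt0.
Qed.

Lemma nash_cost_lt i :
  (cost a c d i (p i) b < disutility c d i (D i)) = (p i != D i).
Proof.
rewrite nash_gain ltrDl pmulr_rgt0 ?cost_curvature_gt0 //.
rewrite lt0r sqr_ge0 andbT sqrf_eq0 nash_production.
by rewrite -[in RHS]subr_eq0 addrAC subrr add0r oppr_eq0.
Qed.

Let objective_curvature i : R := c i - 1 / (2 * (N%:R - 1) * a).

Let objective_curvature_gt0 i : 0 < objective_curvature i.
Proof.
rewrite subr_gt0 (lt_trans _ (c_gt0 i)) // div1r invr_lt0.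
by rewrite pmulr_rlt0 // mulr_gt0.
Qed.

(** By stationarity every partial derivative of the objective at p equals the
    price, so the first-order term of its expansion at p is a multiple of
    \sum_i (q i - p i), which is 0. *)
Lemma objective_at_balanced (q : 'I_N -> R) : balanced D q ->
  objective a c d D q
  = objective a c d D p + \sum_i objective_curvature i * (q i - p i) ^+ 2.
Proof.
move=> q_balanced.
have first_order0 : \sum_i price a b * (q i - p i) = 0.
  by rewrite -mulr_sumr sumrB q_balanced nash_balanced subrr mulr0.
rewrite -[LHS]subr0 -[in LHS]first_order0 /objective -sumrB -big_split /=.
apply: eq_bigr => i _.
have -> : D i = p i + quantity a b i by rewrite nash_production subrK.
rewrite (nash_stationarity i) /objective_curvature.
move: (quantity a b i) => u.
by field; rewrite a_neq0 Nsub1_neq0.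
Qed.

Lemma nash_unique_optimal : unique_optimal a c d D p.
Proof.
have term_ge0 (q : 'I_N -> R) i :
    0 <= objective_curvature i * (q i - p i) ^+ 2.
  by rewrite mulr_ge0 ?sqr_ge0 // ltW.
split=> [|q [q_balanced q_min] i].
  split=> [|q q_balanced]; first exact: nash_balanced.
  by rewrite (objective_at_balanced q_balanced) lerDl sumr_ge0.
have := q_min p nash_balanced.
rewrite (objective_at_balanced q_balanced) gerDl => sum_le0.
have /eqP : \sum_i objective_curvature i * (q i - p i) ^+ 2 = 0.
  by apply/eqP; rewrite eq_le sum_le0 sumr_ge0.
rewrite psumr_eq0 // => /allP /(_ i (mem_index_enum i)) /=.
by rewrite mulf_eq0 gt_eqF //= sqrf_eq0 subr_eq0 => /eqP.
Qed.

End Equilibrium.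

End EnergySharingGame.

Theorem proposition2 (R : realFieldType) (N : nat) (a : R)
    (c d D : 'I_N -> R) (p b : 'I_N -> R)
    (N_ge2 : (2 <= N)%N) (a_lt0 : a < 0)
    (c_gt0 : forall i, 0 < c i) (d_gt0 : forall i, 0 < d i)
    (NE : nash_equilibrium a c d D p b) :
  (forall i, cost a c d i (p i) b <= disutility c d i (D i)) /\
  (~ (unique_optimal a c d D p /\ forall i, p i = D i) ->
   exists i, cost a c d i (p i) b < disutility c d i (D i)).
Proof.
split=> [i|not_autarky]; first exact: nash_cost_le.
apply/existsP; apply: contra_notT not_autarky => /existsPn no_strict.
split=> [|i]; first exact: (nash_unique_optimal N_ge2 a_lt0 c_gt0 NE).
by apply/eqP; have := no_strict i; rewrite (nash_cost_lt N_ge2) // negbK.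
Qed.
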